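(* Let $D\subset\mathbb{R}^P$ be compact and let $A(\mu)=\theta_1(\mu)A_1+\dots+\theta_Q(\mu)A_Q$ for $\mu\in D$, with Hermitian $A_1,\dots,A_Q\in\mathbb{C}^{N\times N}$ and functions $\theta_1,\dots,\theta_Q:D\to\mathbb{R}$. Let $C_J=\{\mu_1,\dots,\mu_J\}\subset D$ be finite and let $\lambda_{\mathrm{UB}}(\mu;C_J)$ be the SCM upper bound defined in the context. Let $\mu_i\in C_J$ lie in the interior of $D$, and assume that $\theta_1,\dots,\theta_Q$ are differentiable at $\mu_i$ and that $\lambda_i=\lambda_{\min}(A(\mu_i))$ is a simple eigenvalue of $A(\mu_i)$. Then $$\nabla \lambda_{\mathrm{UB}}(\mu_i;C_J)=\nabla\lambda_{\min}(A(\mu_i)),$$ where $\nabla$ denotes the gradient with respect to $\mu$ (evaluated at $\mu=\mu_i$) of the functions $\mu\mapsto\lambda_{\mathrm{UB}}(\mu;C_J)$ and $\mu\mapsto\lambda_{\min}(A(\mu))$.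
   Context: $\lambda_{\min}(\cdot)$ denotes the smallest eigenvalue of a Hermitian matrix. Put $\theta(\mu)=[\theta_1(\mu),\dots,\theta_Q(\mu)]^T\in\mathbb{R}^Q$ and, for $u\in\mathbb{C}^N\setminus\{0\}$, $$R(u)=\Big[\tfrac{u^*A_1u}{u^*u},\dots,\tfrac{u^*A_Qu}{u^*u}\Big]^T\in\mathbb{R}^Q .$$ For each $j=1,\dots,J$, let $v_j\in\mathbb{C}^N\setminus\{0\}$ be an eigenvector of $A(\mu_j)$ belonging to its smallest eigenvalue $\lambda_j=\lambda_{\min}(A(\mu_j))$. Define $$\mathcal{Y}_{\mathrm{UB}}(C_J)=\{R(v_j): j=1,\dots,J\},\qquad \lambda_{\mathrm{UB}}(\mu;C_J)=\min_{y\in\mathcal{Y}_{\mathrm{UB}}(C_J)}\theta(\mu)^Ty .$$ *)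

(* Defs.v *)
From HB Require Import structures.
From mathcomp Require Import all_boot all_order all_algebra.
From mathcomp Require Import sesquilinear spectral complex.
From mathcomp Require Import all_classical all_reals all_analysis.

Set Implicit Arguments.
Unset Strict Implicit.
Unset Printing Implicit Defensive.

Import Order.TTheory GRing.Theory Num.Theory.
Import numFieldNormedType.Exports.

Local Open Scope classical_set_scope.
Local Open Scope ring_scope.
Local Open Scope complex_scope.
Local Open Scope sesquilinear_scope.

(* [eigenvalue] refers to row vectors; a matrix and its transpose have the same
   eigenvalues.  For Hermitian A of positive size the set below is finite and
   nonempty, so [inf] is its minimum: see [lambda_minP]. *)
Definition lambda_min (R : realType) (N : nat) (A : 'M[R[i]]_N) : R :=
  inf [set x : R | eigenvalue A x%:C].

(* Algebraic multiplicity one. *)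
Definition simple_eigenvalue (R : realType) (N : nat) (A : 'M[R[i]]_N) (x : R)
  : Prop := mup x%:C (char_poly A) = 1%N.

Definition parametric_mx (R : realType) (P Q N : nat)
    (theta : 'I_Q -> 'rV[R]_P -> R) (A : 'I_Q -> 'M[R[i]]_N) (mu : 'rV[R]_P)
  : 'M[R[i]]_N := \sum_(q < Q) (theta q mu)%:C *: A q.

(* Each quotient is real when the A q are Hermitian, so taking the real part
   only changes its type from R[i] to R. *)
Definition rayleigh (R : realType) (Q N : nat) (A : 'I_Q -> 'M[R[i]]_N)
    (u : 'cV[R[i]]_N) : 'cV[R]_Q :=
  \col_(q < Q)
     complex.Re ((u ^t* *m A q *m u) 0 0 / (u ^t* *m u) 0 0).

Definition Y_UB (R : realType) (Q N J : nat) (A : 'I_Q -> 'M[R[i]]_N)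
    (v : 'I_J -> 'cV[R[i]]_N) : set 'cV[R]_Q :=
  [set y | exists j : 'I_J, y = rayleigh A (v j)].

(* For J > 0 the infimum is over a finite nonempty set, hence a minimum: see
   [lambda_UBP]. *)
Definition lambda_UB (R : realType) (P Q N J : nat)
    (theta : 'I_Q -> 'rV[R]_P -> R) (A : 'I_Q -> 'M[R[i]]_N)
    (v : 'I_J -> 'cV[R[i]]_N) (mu : 'rV[R]_P) : R :=
  inf [set \sum_(q < Q) theta q mu * y q 0 | y in Y_UB A v].

(* Vector of partial derivatives; 'D_ is a limit with a default value, so
   equality of gradients is meaningful together with [differentiable]. *)
Definition gradient (R : realType) (P : nat) (f : 'rV[R]_P -> R)
    (x : 'rV[R]_P) : 'rV[R]_P :=
  \row_(k < P) 'D_(delta_mx 0 k) f x.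

Lemma inf_seq_min (R : realType) (E : set R) (s : seq R) :
  E !=set0 -> (forall x, E x -> x \in s) ->
  E (inf E) /\ forall x, E x -> inf E <= x.
Proof.
move=> E0 Es.
suff [m Em mE] : exists2 m, E m & forall x, E x -> m <= x.
  suff -> : inf E = m by [].
  apply/eqP; rewrite eq_le; apply/andP; split; last exact: lb_le_inf.
  by apply: ge_inf => //; exists m.
case: E0 => x0 Ex0.
elim: s E x0 Ex0 Es => [|a s IHs] E x0 Ex0 Es; first by have := Es _ Ex0.
have Es' x : E x -> x != a -> x \in s.
  by move=> /Es; rewrite inE => /orP[/eqP ->|//]; rewrite eqxx.
have [[y [Ey ya]]|nE] := pselect (exists y, E y /\ y != a).
  have [|m [Em ma] mE] := IHs [set y | E y /\ y != a] y (conj Ey ya).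
    by move=> x [Ex xa]; exact: Es'.
  have [Ea|nEa] := pselect (E a); last first.
    exists m => // x Ex; apply: mE; split=> //.
    by apply/eqP => xa; apply: nEa; rewrite -xa.
  have [am|ma'] := leP a m.
    exists a => // x Ex; have [->//|xa] := eqVneq x a.
    by apply: le_trans am _; exact: mE.
  exists m => // x Ex; have [->|xa] := eqVneq x a; first exact: ltW.
  exact: mE.
have all_a x : E x -> x = a.
  by move=> Ex; apply/eqP/negPn/negP => xa; apply: nE; exists x.
by exists x0 => // x Ex; rewrite (all_a _ Ex) (all_a _ Ex0).
Qed.

Lemma hermitian_eigenvalue_real (R : realType) (N : nat) (A : 'M[R[i]]_N)
    (a : R[i]) :
  A \is hermsymmx -> eigenvalue A a -> exists x : R, a = x%:C.
Proof.
move=> Ah /eigenvalueP[v va v0].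
have AE : A ^t* = A.
  by move: Ah => /is_hermitianmxP Ah; rewrite {2}Ah expr0 scale1r.
have vv : (v *m v ^t*) 0 0 != 0.
  by rewrite -dotmxE dnorm_eq0.
have e1 : (v *m A *m v ^t*) 0 0 = a * (v *m v ^t*) 0 0.
  by rewrite va -scalemxAl mxE.
have e2 : (v *m A *m v ^t*) 0 0 = a^* * (v *m v ^t*) 0 0.
  have -> : v *m A *m v ^t* = v *m (v *m A) ^t*.
    by rewrite trmx_mul map_mxM mulmxA AE.
  by rewrite va linearZ /= map_mxZ -scalemxAr mxE.
have /(mulIf vv) ac : a * (v *m v ^t*) 0 0 = a^* * (v *m v ^t*) 0 0.
  by rewrite -e1 e2.
have /complex_realP [x ->] : a \is Num.real by apply/CrealP; rewrite -ac.
by exists x.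
Qed.

Lemma lambda_minP (R : realType) (N : nat) (A : 'M[R[i]]_N) :
  (0 < N)%N -> A \is hermsymmx ->
  eigenvalue A (lambda_min A)%:C /\
  forall x : R, eigenvalue A x%:C -> lambda_min A <= x.
Proof.
move=> N0 Ah.
have [r rE] := closed_field_poly_normal (char_poly A).
apply: (@inf_seq_min _ [set x : R | eigenvalue A x%:C]
  [seq complex.Re z | z <- r]).
  have [a Aa] := eigenvalue_closed A N0.
  by have [x ax] := hermitian_eigenvalue_real Ah Aa; exists x; rewrite /= -ax.
move=> x /=; rewrite eigenvalue_root_char rE.
rewrite (monicP (char_poly_monic A)) scale1r root_prod_XsubC => xr.
by apply/mapP; exists x%:C.
Qed.

Lemma lambda_UBP (R : realType) (P Q N J : nat)
    (theta : 'I_Q -> 'rV[R]_P -> R) (A : 'I_Q -> 'M[R[i]]_N)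
    (v : 'I_J -> 'cV[R[i]]_N) (mu : 'rV[R]_P) : (0 < J)%N ->
  (exists2 y, Y_UB A v y &
     lambda_UB theta A v mu = \sum_(q < Q) theta q mu * y q 0) /\
  forall y, Y_UB A v y ->
     lambda_UB theta A v mu <= \sum_(q < Q) theta q mu * y q 0.
Proof.
move=> J0; pose F y := \sum_(q < Q) theta q mu * (y : 'cV[R]_Q) q 0.
have [] := @inf_seq_min _ (F @` Y_UB A v)
  [seq F (rayleigh A (v j)) | j <- enum 'I_J].
- by exists (F (rayleigh A (v (Ordinal J0)))), (rayleigh A (v (Ordinal J0))) => //;
    exists (Ordinal J0).
- move=> x [y [j ->] <-]; apply/mapP; exists j => //; exact: mem_enum.
move=> [y Yy yE] le; split; first by exists y.
by move=> z Yz; apply: le; exists z.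
Qed.

(* Main.v *)
(** Let [l = lambda_min (A (mu i))], let [v = v i], and let [h m] be the Rayleigh
    quotient of [A m] at [v], that is [theta(m)^T R(v)].  Then
    [lambda_min <= lambda_UB <= h], with equality at [mu i].  Since [l] is simple,
    the form of [A (mu i)] is at least [l + g], with [g > 0], on the orthogonal
    complement of [v]; this yields, for [m] near [mu i],
      [lambda_min (A m) >= h m - \sum_q c q * (theta q m - theta q (mu i)) ^+ 2].
    The correction vanishes to first order at [mu i], so both functions are
    differentiable there with the same differential as [h]. *)
Require Import Defs.
From HB Require Import structures.
From mathcomp Require Import all_boot all_order all_algebra.
From mathcomp Require Import sesquilinear spectral complex.
From mathcomp Require Import all_classical all_reals all_analysis.
From mathcomp Require Import ring lra.

Set Implicit Arguments.
Unset Strict Implicit.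
Unset Printing Implicit Defensive.

Import Order.TTheory GRing.Theory Num.Theory.
Import numFieldNormedType.Exports.

Local Open Scope classical_set_scope.
Local Open Scope ring_scope.
Local Open Scope complex_scope.

(** * Real-variable tools: differentiability by comparison, and a weighted inequality *)

(** The bound at [x] forces [k x = 0]. Since [b] vanishes at [x] together with its differential, it
    is little-o of the increment, and this passes to [k]. *)
Lemma is_diff0_le (R : realType) (V : normedModType R) (b k : V -> R) (x : V) :
  is_diff x b 0 -> b x = 0 -> (\forall y \near x, `|k y| <= b y) ->
  is_diff x k 0.
Proof.
move=> dfb bx kb.
have kx : k x = 0.
  by apply/eqP; rewrite -normr_le0 -bx; exact: nbhs_singleton kb.
have ko : k \o shift x = cst (k x) + 0 +o_ 0 id.
  rewrite kx addr0; apply/eqaddoP => e e0.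
  have /diff_locally := @ex_diff _ _ _ _ _ _ _ dfb.
  rewrite (@diff_val _ _ _ _ _ _ _ dfb) bx addr0.
  move=> /eqadd_some_oP /(_ e e0).
  have : \forall h \near 0, `|k (h + x)| <= b (h + x).
    by move: kb; rewrite (near_shift 0) /= subr0.
  apply: filterS2 => h /= kh; rewrite !fctE /= !subr0.
  by move=> hb; apply: le_trans hb; exact: le_trans kh (ler_norm _).
have dk : 'd k x = 0 :> (V -> R).
  by apply: (@diff_unique _ _ _ k \0 x) => //; exact: cst_continuous.
apply: DiffDef => //; apply/diff_locallyP; rewrite dk; split => //.
exact: cst_continuous.
Qed.

(** Near [x] the difference [f - h] lies between [- b] and 0, so its differential there is zero. *)
Lemma is_diff_sandwich (R : realType) (V : normedModType R) (b f h dh : V -> R)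
    (x : V) :
  is_diff x b 0 -> b x = 0 -> is_diff x h dh ->
  (\forall y \near x, h y - b y <= f y <= h y) -> is_diff x f dh.
Proof.
move=> dfb bx dfh hf.
have dk : is_diff x (f - h) 0.
  apply: is_diff0_le dfb bx _; apply: filterS hf => y /andP[h1 h2].
  by rewrite !fctE /= distrC ger0_norm; lra.
have -> : f = h + (f - h) by rewrite addrC subrK.
by apply: is_diff_eq; rewrite addr0.
Qed.

Lemma is_diff_sum_sqr0 (R : realType) (V : normedModType R) (Q : nat)
    (c : 'I_Q -> R) (theta : 'I_Q -> V -> R) (x : V) :
  (forall q, differentiable (theta q) x) ->
  is_diff x (fun y => \sum_(q < Q) c q * (theta q y - theta q x) ^+ 2) 0.
Proof.
move=> dt.
have -> : (fun y => \sum_(q < Q) c q * (theta q y - theta q x) ^+ 2) =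
    \sum_(q < Q) (c q *: (theta q - cst (theta q x)) ^+ 2).
  by apply/funext => y; rewrite fct_sumE.
elim/big_ind : _ => [|f g df dg|q _]; first exact: is_diff_cst.
  by apply: is_diff_eq; rewrite addr0.
have /differentiableP dq := dt q.
apply: is_diff_eq.
(* Differentiating the square leaves the factor [theta q x - theta q x]. *)
by rewrite expr1 [X in 2 * X]subrr mulr0 scale0r scaler0.
Qed.

Lemma gradient_is_diff (R : realType) (P : nat) (f df : 'rV[R]_P -> R)
    (x : 'rV[R]_P) :
  is_diff x f df -> gradient f x = \row_(k < P) df (delta_mx 0 k).
Proof.
move=> dff; apply/rowP => k; rewrite !mxE deriveE; last exact: ex_diff.
by rewrite (@diff_val _ _ _ _ _ _ _ dff).
Qed.

(** Young's inequality, from expanding [(|x| a - s b) ^+ 2 / s]. The factor [x ^+ 2] falls on [a]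
    alone while [b] only gets the weight [s]; this asymmetry makes the later correction
    quadratic. *)
Lemma mulr_weighted_le (R : realFieldType) (x s a b : R) : 0 < s ->
  2 * `|x| * a * b <= x ^+ 2 / s * a ^+ 2 + s * b ^+ 2.
Proof.
move=> s0; have : 0 <= (`|x| * a - s * b) ^+ 2 / s.
  by rewrite divr_ge0 ?sqr_ge0 // ltW.
have -> : (`|x| * a - s * b) ^+ 2 / s =
    x ^+ 2 / s * a ^+ 2 + s * b ^+ 2 - 2 * `|x| * a * b.
  by rewrite -[x ^+ 2]real_normK ?num_real //; field; exact: lt0r_neq0.
by rewrite subr_ge0.
Qed.

(** * Sesquilinear forms and elementary bounds *)

Section QuadraticForms.
Local Open Scope sesquilinear_scope.
Variables (R : realType) (N : nat).
Implicit Types (M : 'M[R[i]]_N) (u w p v : 'cV[R[i]]_N).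

(** The real part keeps all estimates in [R]; for Hermitian [M] the result is symmetric in [u] and
    [w], and nothing is lost when [u = w]. *)
Definition sesqui M u w : R := complex.Re ((u ^t* *m M *m w) 0 0).

Definition sqnorm u : R := \sum_k Normc.normc (u k 0) ^+ 2.

Lemma ReD (x y : R[i]) : complex.Re (x + y) = complex.Re x + complex.Re y.
Proof. by case: x y => [a b] [c d]. Qed.

Lemma ReZ (a : R) (x : R[i]) : complex.Re (a%:C * x) = a * complex.Re x.
Proof. by case: x => [c d] /=; rewrite mul0r subr0. Qed.

Lemma sesquiDl M u w p : sesqui M (u + w) p = sesqui M u p + sesqui M w p.
Proof. by rewrite /sesqui raddfD /= map_mxD !mulmxDl mxE ReD. Qed.

Lemma sesquiDr M u w p : sesqui M p (u + w) = sesqui M p u + sesqui M p w.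
Proof. by rewrite /sesqui mulmxDr mxE ReD. Qed.

Lemma sesquiDm M M' u w : sesqui (M + M') u w = sesqui M u w + sesqui M' u w.
Proof. by rewrite /sesqui mulmxDr mulmxDl mxE ReD. Qed.

Lemma sesquiZm (a : R) M u w : sesqui (a%:C *: M) u w = a * sesqui M u w.
Proof. by rewrite /sesqui -scalemxAr -scalemxAl mxE ReZ. Qed.

Lemma sesqui_sumZ (Q : nat) (x : 'I_Q -> R) (A : 'I_Q -> 'M[R[i]]_N) u w :
  sesqui (\sum_(q < Q) (x q)%:C *: A q) u w =
  \sum_(q < Q) x q * sesqui (A q) u w.
Proof.
elim/big_ind2 : _ => [|M a M' b <- <-|q _]; last exact: sesquiZm.
  by rewrite /sesqui mulmx0 mul0mx mxE.
exact: sesquiDm.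
Qed.

Lemma ReJ (x : R[i]) : complex.Re x^* = complex.Re x.
Proof. by case: x. Qed.

Lemma sesqui_sym M u w : M ^t* = M -> sesqui M u w = sesqui M w u.
Proof.
move=> Mh; rewrite /sesqui -[RHS]ReJ.
have -> : ((w ^t* *m M *m u) 0 0)^* = ((w ^t* *m M *m u) ^t*) 0 0.
  by rewrite !mxE.
by rewrite !trmx_mul !map_mxM trmxCK Mh mulmxA.
Qed.

Lemma mulmx_sqnorm u : (u ^t* *m u) 0 0 = (sqnorm u)%:C.
Proof.
rewrite mxE /sqnorm rmorph_sum /=; apply: eq_bigr => k _.
by rewrite !mxE mulrC -normCK normc_def rmorphXn /=; case: (u k 0).
Qed.

Lemma sesqui_eigen M v (l : R) : M *m v = l%:C *: v ->
  sesqui M v v = l * sqnorm v.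
Proof.
by move=> Mv; rewrite /sesqui -mulmxA Mv -scalemxAr mxE mulmx_sqnorm ReZ.
Qed.

Lemma sqnorm_gt0 u : u != 0 -> 0 < sqnorm u.
Proof.
move=> u0; rewrite lt_def sumr_ge0 ?andbT => [|k _]; last exact: sqr_ge0.
apply: contra u0 => /eqP; rewrite /sqnorm => /psumr_eq0P su.
apply/eqP/colP => k.
rewrite mxE; apply/(@Normc.eq0_normc R)/eqP; rewrite -sqrf_eq0.
by apply/eqP/su => // j _; exact: sqr_ge0.
Qed.

Lemma rayleighE (Q : nat) (A : 'I_Q -> 'M[R[i]]_N) u q :
  rayleigh A u q 0 = sesqui (A q) u u / sqnorm u.
Proof.
rewrite mxE mulmx_sqnorm mulrC -(fmorphV (real_complex R)) /= ReZ mulrC.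
by [].
Qed.

(** Linearity of the form in its matrix is what makes each candidate in [lambda_UB] a Rayleigh
    quotient of the parametric matrix. *)
Lemma sum_rayleigh (Q : nat) (x : 'I_Q -> R) (A : 'I_Q -> 'M[R[i]]_N) u :
  \sum_(q < Q) x q * rayleigh A u q 0 =
  sesqui (\sum_(q < Q) (x q)%:C *: A q) u u / sqnorm u.
Proof.
rewrite sesqui_sumZ mulr_suml; apply: eq_bigr => q _.
by rewrite rayleighE mulrA.
Qed.

Lemma normr_Re_le (x : R[i]) : `|complex.Re x| <= Normc.normc x.
Proof. by rewrite -lecR normc_ge_Re. Qed.

Lemma sqnorm_ge u k : Normc.normc (u k 0) ^+ 2 <= sqnorm u.
Proof.
rewrite /sqnorm (bigD1 k) //= lerDl sumr_ge0 // => j _; exact: sqr_ge0.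
Qed.

Lemma Re_sum (I : Type) (r : seq I) (F : I -> R[i]) :
  complex.Re (\sum_(k <- r) F k) = \sum_(k <- r) complex.Re (F k).
Proof. by apply: (big_morph _ ReD). Qed.

Lemma normc_ge0 (x : R[i]) : 0 <= Normc.normc x.
Proof. by case: x => a b; exact: sqrtr_ge0. Qed.

Lemma normc_conj (x : R[i]) : Normc.normc x^* = Normc.normc x.
Proof. by case: x => a b /=; rewrite sqrrN. Qed.

Lemma Re_conjM_ge (x s : R) (a m b : R[i]) : 0 < s ->
  - (Normc.normc m *
     (x ^+ 2 / s * Normc.normc a ^+ 2 + s * Normc.normc b ^+ 2)) <=
  2 * x * complex.Re (a^* * m * b).
Proof.
move=> s0; rewrite lerNl.
apply: le_trans (ler_norm _) _; rewrite normrN normrM.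
apply: le_trans (ler_wpM2l (normr_ge0 _) (normr_Re_le _)) _.
rewrite !Normc.normcM normc_conj normrM (ger0_norm (ler0n _ 2)).
rewrite [leLHS](_ : _ = Normc.normc m *
    (2 * `|x| * Normc.normc a * Normc.normc b)); last by ring.
by apply: ler_wpM2l; [exact: normc_ge0 | exact: mulr_weighted_le].
Qed.

(** Young's inequality entry by entry, with [K] the sum of the moduli of the entries, so that one
    constant serves all [x], [s], [p] and [w]. *)
Lemma sesqui_ge M : exists2 K, 0 <= K & forall (x s : R) p w, 0 < s ->
  - (K * (x ^+ 2 / s * sqnorm p + s * sqnorm w)) <= 2 * x * sesqui M p w.
Proof.
exists (\sum_j \sum_k Normc.normc (M k j)).
  by do 2!apply: sumr_ge0 => ? _; exact: normc_ge0.
move=> x s p w s0; set B := (_ + _ : R).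
rewrite /sesqui mxE Re_sum mulr_sumr mulr_suml -sumrN.
apply: ler_sum => j _; rewrite mxE !mulr_suml Re_sum mulr_sumr -sumrN.
apply: ler_sum => k _; rewrite !mxE.
apply: le_trans (Re_conjM_ge x (p k 0) (M k j) (w j 0) s0).
rewrite lerN2; apply: ler_wpM2l; first exact: normc_ge0.
apply: lerD; apply: ler_wpM2l; try exact: sqnorm_ge; last exact: ltW.
by apply: mulr_ge0; [exact: sqr_ge0 | rewrite invr_ge0 ltW].
Qed.

(** * Unitary diagonalization of Hermitian matrices *)

Lemma hermsymmxP M : M \is hermsymmx -> M ^t* = M.
Proof. by move=> /is_hermitianmxP Mh; rewrite [RHS]Mh expr0 scale1r. Qed.

Lemma spectral_decomposition M : M \is hermsymmx ->
  exists U : 'M[R[i]]_N, exists d : 'I_N -> R,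
    U \is unitarymx /\ M = U ^t* *m diag_mx (\row_k (d k)%:C) *m U.
Proof.
move=> Mh; exists (spectralmx M), (fun k => complex.Re (spectral_diag M 0 k)).
split; first exact: spectral_unitarymx.
have /orthomx_spectralP := hermitian_normalmx Mh.
rewrite invmx_unitary ?spectral_unitarymx // => {1}->.
congr (_ *m diag_mx _ *m _); apply/rowP => k; rewrite mxE.
by rewrite RRe_real //; apply/mxOverP/hermitian_spectral_diag_real.
Qed.

Section Spectral.
Variables (M U : 'M[R[i]]_N) (d : 'I_N -> R).
Hypothesis U_unitary : U \is unitarymx.
Hypothesis ME : M = U ^t* *m diag_mx (\row_k (d k)%:C) *m U.

Let UK : U ^t* *m U = 1%:M.
Proof. by apply: mulmx1C; exact/unitarymxP. Qed.

Lemma sqnorm_unitary u : sqnorm (U *m u) = sqnorm u.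
Proof.
apply: complexI; rewrite -!mulmx_sqnorm trmx_mul map_mxM mulmxA.
by rewrite -[_ *m _ *m U]mulmxA UK mulmx1.
Qed.

Lemma sesqui_spectral u :
  sesqui M u u = \sum_k d k * Normc.normc ((U *m u) k 0) ^+ 2.
Proof.
rewrite /sesqui ME !mulmxA -map_mxM -trmx_mul -mulmxA mxE Re_sum.
apply: eq_bigr => k _; rewrite mul_mx_diag !mxE mulrAC mulrC.
rewrite ReZ [X in complex.Re X]mulrC -normCK normc_def -rmorphXn /=.
by case: (\sum_j _).
Qed.

(** The unitary change of basis fixes ['X%:M], so the determinant reduces to that of a diagonal
    matrix. *)
Lemma char_poly_spectral : char_poly M =
  \prod_(z <- [seq (d k)%:C | k <- enum 'I_N]) ('X - z%:P).
Proof.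
have UT : map_mx polyC (U ^t*) *m map_mx polyC U = 1%:M.
  by rewrite -map_mxM UK map_mx1.
have XE : 'X%:M = map_mx polyC (U ^t*) *m 'X%:M *m map_mx polyC U.
  by rewrite mul_mx_scalar -scalemxAl UT scalemx1.
rewrite /char_poly /char_poly_mx {1}ME !map_mxM XE -mulmxBl -mulmxBr.
rewrite !det_mulmx mulrAC -det_mulmx UT det1 mul1r.
rewrite map_diag_mx -(diag_const_mx N 'X) -raddfB /= det_diag.
by rewrite big_map big_enum; apply: eq_bigr => k _; rewrite !mxE.
Qed.

Lemma eigenvalue_spectral k : eigenvalue M (d k)%:C.
Proof.
rewrite eigenvalue_root_char char_poly_spectral root_prod_XsubC.
by apply: map_f; rewrite mem_enum.
Qed.

(** The multiplicity of [l] in the product counts the indices with [d k = l]; being one, it leaves a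
    single index. *)
Lemma simple_eigenvalue_spectral (l : R) : simple_eigenvalue M l ->
  exists k, forall j, (d j == l) = (j == k).
Proof.
rewrite /simple_eigenvalue char_poly_spectral mu_prod_XsubC.
rewrite count_map -size_filter.
set s := [seq k <- _ | _]; case sE : s => [|k [|//]] // _; exists k => j.
have : (j \in s) = (d j == l).
  by rewrite mem_filter mem_enum andbT /= (inj_eq (@complexI R)).
by rewrite sE inE => ->.
Qed.

Lemma eigenvector_spectral v (l : R) j : M *m v = l%:C *: v -> d j != l ->
  (U *m v) j 0 = 0.
Proof.
move=> /(congr1 (mulmx U)); rewrite ME !mulmxA (unitarymxP U_unitary) mul1mx.
rewrite -mulmxA -scalemxAr => /colP /(_ j); rewrite mul_diag_mx !mxE.
move=> /eqP; rewrite -subr_eq0 -mulrBl -rmorphB mulf_eq0 => /orP[|/eqP//].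
by rewrite (inj_eq (@complexI R) _ 0) subr_eq0 => ->.
Qed.

End Spectral.

(** * Variational bounds for the smallest eigenvalue *)

Lemma lambda_min_sesqui_le M u : M \is hermsymmx ->
  lambda_min M * sqnorm u <= sesqui M u u.
Proof.
move=> Mh; have [U [d [Uu ME]]] := spectral_decomposition Mh.
rewrite (sesqui_spectral ME) -(sqnorm_unitary Uu) mulr_sumr.
apply: ler_sum => k _; apply: ler_wpM2r; first exact: sqr_ge0.
have N0 : (0 < N)%N by case: (N) k => [[]|].
by have [_] := lambda_minP N0 Mh; apply; exact: eigenvalue_spectral Uu ME _.
Qed.

(** In the coordinates given by [U], simplicity leaves one index [k] where [d] is minimal. The
    vector [v] lives on that coordinate alone, so every [w] orthogonal to [v] avoids it. *)
Lemma spectral_gap M v : M \is hermsymmx ->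
  simple_eigenvalue M (lambda_min M) -> v != 0 ->
  M *m v = (lambda_min M)%:C *: v ->
  exists2 g, 0 < g & forall w, (v ^t* *m w) 0 0 = 0 ->
    (lambda_min M + g) * sqnorm w <= sesqui M w w.
Proof.
move=> Mh Ms v0 Mv; have [U [d [Uu ME]]] := spectral_decomposition Mh.
have [k kE] := simple_eigenvalue_spectral Uu ME Ms.
have lm j : lambda_min M <= d j.
  have N0 : (0 < N)%N by case: (N) j => [[]|].
  by have [_] := lambda_minP N0 Mh; apply; exact: eigenvalue_spectral Uu ME _.
have UV0 j : j != k -> (U *m v) j 0 = 0.
  by rewrite -kE => /(eigenvector_spectral Uu ME Mv).
have UVk : (U *m v) k 0 != 0.
  apply: contra v0 => /eqP Uk; rewrite -[v]mul1mx -(mulmx1C (unitarymxP Uu)).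
  rewrite -mulmxA [U *m v](_ : _ = 0) ?mulmx0 //; apply/colP => j.
  by rewrite [RHS]mxE; have [->|/UV0] := eqVneq j k.
(* Distance to the next eigenvalue, capped by the default 1, which is the value when [k] is the only
   index. *)
exists (\big[Num.min/1]_(j | j != k) (d j - lambda_min M)).
  apply/bigmin_gtP; split=> // j jk.
  by rewrite subr_gt0 lt_neqAle lm eq_sym kE jk.
move=> w vw.
have adjE (z : 'cV[R[i]]_N) j : (z ^t*) 0 j = (z j 0)^* by rewrite 2!mxE.
have UWk : (U *m w) k 0 = 0.
  have : ((U *m v) ^t* *m (U *m w)) 0 0 = 0.
    rewrite trmx_mul map_mxM mulmxA -[_ *m _ *m U]mulmxA.
    by rewrite (mulmx1C (unitarymxP Uu)) mulmx1.
  rewrite mxE (bigD1 k) //= big1 ?addr0 => [|j jk].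
    by rewrite adjE => /eqP; rewrite mulf_eq0 conjC_eq0 (negPf UVk) => /eqP.
  by rewrite adjE UV0 // rmorph0 mul0r.
rewrite (sesqui_spectral ME) -(sqnorm_unitary Uu) mulr_sumr.
apply: ler_sum => j _; have [->|jk] := eqVneq j k.
  by rewrite UWk Normc.normc0 expr0n !mulr0.
apply: ler_wpM2r; first exact: sqr_ge0.
by rewrite addrC -lerBrDr; exact: bigmin_le_cond.
Qed.

(** * Lower bound for a perturbed form *)

Lemma sqnorm_sesqui u : sqnorm u = sesqui 1%:M u u.
Proof. by rewrite /sesqui mulmx1 mulmx_sqnorm. Qed.

Lemma sesqui_scale M (a : R[i]) v :
  sesqui M (a *: v) (a *: v) = Normc.normc a ^+ 2 * sesqui M v v.
Proof.
rewrite /sesqui [(a *: v)^T]linearZ /= map_mxZ.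
rewrite -!scalemxAl -scalemxAr scalerA mxE.
rewrite -ReZ; congr (complex.Re (_ * _)).
by rewrite mulrC -normCK normc_def rmorphXn /=; case: a.
Qed.

(** [eigenvalue] yields a row vector; as [M] is Hermitian and the eigenvalue real, its adjoint is a
    column eigenvector. *)
Lemma lambda_min_eigenvector M : (0 < N)%N -> M \is hermsymmx ->
  exists2 u : 'cV[R[i]]_N, u != 0 & M *m u = (lambda_min M)%:C *: u.
Proof.
move=> N0 Mh; have [/eigenvalueP[r rM r0] _] := lambda_minP N0 Mh.
exists (r ^t*); first by rewrite map_mx_eq0 trmx_eq0.
rewrite -{1}(hermsymmxP Mh) -map_mxM -trmx_mul rM.
rewrite [(_ *: r)^T]linearZ /= map_mxZ.
by congr (_ *: _); apply/conj_Creal/complex_realP; exists (lambda_min M).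
Qed.

(* Split [u = p + w] with [p] parallel and [w] orthogonal to [v].  The first
   order part of the perturbation only enters through the cross term between
   [p] and [w], which the spectral gap [g] absorbs up to a second order term. *)
Lemma sesqui_perturbation_ge (Q : nat) (A : 'I_Q -> 'M[R[i]]_N) M0 v (l g : R) :
  M0 ^t* = M0 -> v != 0 -> M0 *m v = l%:C *: v -> 0 < g ->
  (forall w, (v ^t* *m w) 0 0 = 0 -> (l + g) * sqnorm w <= sesqui M0 w w) ->
  exists c : 'I_Q -> R, exists2 delta, 0 < delta &
    forall (x : 'I_Q -> R) M, M ^t* = M ->
    M = M0 + \sum_(q < Q) (x q)%:C *: A q ->
    (forall q, `|x q| <= delta) ->
    sesqui M v v / sqnorm v <= l + g / 4 -> forall u,
    (sesqui M v v / sqnorm v - \sum_(q < Q) c q * x q ^+ 2) * sqnorm u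
      <= sesqui M u u.
Proof.
move=> M0h v0 M0v g0 gap.
have /choice[K KP] q : exists K, 0 <= K /\ forall (x s : R) p w, 0 < s ->
    - (K * (x ^+ 2 / s * sqnorm p + s * sqnorm w)) <= 2 * x * sesqui (A q) p w.
  by have [K K0 KP] := sesqui_ge (A q); exists K.
pose Kt := \sum_q K q.
have Kt0 : 0 <= Kt by apply: sumr_ge0 => q _; case: (KP q).
(* Chosen so that [Kt * delta <= g / 4]; the added 1 keeps the denominator positive when
   [Kt = 0]. *)
pose delta := g / (4 * (Kt + 1)).
have delta0 : 0 < delta.
  by apply: divr_gt0 => //; apply: mulr_gt0 => //; rewrite ltr_wpDl.
have Ktd : Kt * delta <= g / 4.
  rewrite -[leRHS](_ : (Kt + 1) * delta = _).
    by apply: ler_wpM2r; [exact: ltW | rewrite lerDl].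
  by rewrite /delta; field; rewrite lt0r_neq0 // ltr_wpDl.
(* These coefficients are what Young's inequality produces with weight [s = delta]. *)
exists (fun q => K q / delta), delta => // x M Mh ME xd hle u.
set h := _ / _ in hle *; set B := \sum_q _.
have B0 : 0 <= B.
  apply: sumr_ge0 => q _; apply: mulr_ge0; last exact: sqr_ge0.
  by apply: mulr_ge0; [case: (KP q) | rewrite invr_ge0 ltW].
have nv0 := sqnorm_gt0 v0.
have nnge0 z : 0 <= sqnorm z by apply: sumr_ge0 => k _; exact: sqr_ge0.
pose a := (v ^t* *m u) 0 0 / (v ^t* *m v) 0 0.
pose p := a *: v; pose w := u - p.
have vw : v ^t* *m w = 0.
  apply/matrixP => i j; rewrite !ord1 [RHS]mxE /w /p mulmxBr -scalemxAr mxE.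
  rewrite [X in _ + X]mxE [X in _ - X]mxE divfK ?subrr // mulmx_sqnorm.
  by rewrite (inj_eq (@complexI R) _ 0) lt0r_neq0.
have pE : p + w = u by rewrite addrC subrK.
clearbody w.
have pw1 : sesqui 1%:M p w = 0.
  rewrite /sesqui mulmx1 /p [(a *: v)^T]linearZ /= map_mxZ -scalemxAl vw.
  by rewrite scaler0 mxE.
have wp1 : sesqui 1%:M w p = 0 by rewrite sesqui_sym // trmx1 map_mx1.
(* Since [p] is an eigenvector direction of [M0], orthogonality to [w] also holds for the form of
   [M0]; only [E] contributes a cross term. *)
have pw0 : sesqui M0 p w = 0.
  rewrite sesqui_sym // /sesqui -mulmxA /p -scalemxAr M0v scalerA mulrC.
  rewrite -scalerA -/p -scalemxAr mxE ReZ.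
  by move: wp1; rewrite /sesqui mulmx1 => ->; rewrite mulr0.
have ww0 : (l + g) * sqnorm w <= sesqui M0 w w by apply: gap; rewrite vw mxE.
have nu : sqnorm u = sqnorm p + sqnorm w.
  by rewrite -pE !sqnorm_sesqui sesquiDl !sesquiDr pw1 wp1 addr0 add0r.
pose E : 'M[R[i]]_N := \sum_(q < Q) (x q)%:C *: A q.
(* Used twice: [z = p] controls the cross term, [z = w] the perturbation on [w] itself. *)
have Epw z : - (B * sqnorm z + g / 4 * sqnorm w) <= 2 * sesqui E z w.
  rewrite sesqui_sumZ [leRHS]mulr_sumr.
  apply: (@le_trans _ _ (- (B * sqnorm z + Kt * delta * sqnorm w))).
    by rewrite lerN2 lerD2l; apply: ler_wpM2r.
  rewrite /B /Kt !mulr_suml -big_split /= -sumrN; apply: ler_sum => q _.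
  have [_ /(_ (x q) delta z w delta0)] := KP q; rewrite mulrA.
  by congr (_ <= _); ring.
have Bg : B <= g / 4.
  apply: le_trans Ktd; rewrite /B /Kt mulr_suml; apply: ler_sum => q _.
  rewrite -mulrA; apply: ler_wpM2l; first by case: (KP q).
  rewrite mulrC ler_pdivrMr // -[x q ^+ 2]real_normK ?num_real // -expr2.
  by rewrite ler_sqr ?nnegrE ?normr_ge0 // ltW.
have pp : sesqui M p p = h * sqnorm p.
  rewrite sqnorm_sesqui !sesqui_scale -sqnorm_sesqui /h.
  by field; exact: lt0r_neq0.
have MD z1 z2 : sesqui M z1 z2 = sesqui M0 z1 z2 + sesqui E z1 z2.
  by rewrite ME sesquiDm.
have uu : sesqui M u u = sesqui M p p + 2 * sesqui E p w + sesqui M0 w w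
    + sesqui E w w.
  rewrite -{1 2}pE sesquiDl !sesquiDr [sesqui M w p]sesqui_sym //.
  by rewrite [sesqui M p w]MD [sesqui M w w]MD pw0; ring.
have Ep := Epw p; have Ew := Epw w.
have hw : h * sqnorm w <= (l + g / 4) * sqnorm w by apply: ler_wpM2r.
have Bw : B * sqnorm w <= g / 4 * sqnorm w by apply: ler_wpM2r.
have gw : 0 <= g * sqnorm w by apply: mulr_ge0 => //; exact: ltW.
have Bw0 : 0 <= B * sqnorm w by apply: mulr_ge0.
(* On [w], the gap [g] covers three losses of at most [g / 4] each: the cross term, [E] on [w]
   (through [B <= g / 4]), and the excess of [h] over [l]. On [p] only [B] is lost. *)
rewrite uu pp nu; clear - ww0 Ep Ew hw Bw gw Bw0; lra.
Qed.

End QuadraticForms.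

(** * The parametric family and equality of the gradients *)

Lemma hermsymmx_parametric (R : realType) (P Q N : nat)
    (theta : 'I_Q -> 'rV[R]_P -> R) (A : 'I_Q -> 'M[R[i]]_N) (m : 'rV[R]_P) :
  (forall q, A q \is hermsymmx) -> parametric_mx theta A m \is hermsymmx.
Proof.
move=> hA; apply/is_hermitianmxP; rewrite expr0 scale1r /parametric_mx.
rewrite raddf_sum /= map_mx_sum; apply: eq_bigr => q _.
rewrite [(_ *: A q)^T]linearZ /= map_mxZ (hermsymmxP (hA q)).
congr (_ *: _); apply/esym/conj_Creal/complex_realP; by exists (theta q m).
Qed.

Theorem theorem2p1 (R : realType) (P Q N J : nat) (D : set 'rV[R]_P)
    (theta : 'I_Q -> 'rV[R]_P -> R) (A : 'I_Q -> 'M[R[i]]_N)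
    (mu : 'I_J -> 'rV[R]_P) (v : 'I_J -> 'cV[R[i]]_N) (i : 'I_J)
    (compactD : compact D)
    (hermA : forall q : 'I_Q, A q \is hermsymmx)
    (muD : forall j : 'I_J, D (mu j))
    (v_neq0 : forall j : 'I_J, v j != 0)
    (v_eigen : forall j : 'I_J,
       parametric_mx theta A (mu j) *m v j =
         (lambda_min (parametric_mx theta A (mu j)))%:C *: v j)
    (mui_interior : interior D (mu i))
    (theta_diff : forall q : 'I_Q, differentiable (theta q) (mu i))
    (mui_simple : simple_eigenvalue (parametric_mx theta A (mu i))
       (lambda_min (parametric_mx theta A (mu i)))) :
  [/\ differentiable (lambda_UB theta A v) (mu i),
      differentiable (fun m => lambda_min (parametric_mx theta A m)) (mu i)
    & gradient (lambda_UB theta A v) (mu i) =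
      gradient (fun m => lambda_min (parametric_mx theta A m)) (mu i)].
Proof.
pose M m := parametric_mx theta A m.
have hM m : M m \is hermsymmx := hermsymmx_parametric theta m hermA.
have N0 : (0 < N)%N.
  case: (posnP N) => // N0; case/negP: (v_neq0 i); apply/eqP/colP => k.
  by have := ltn_ord k; rewrite [X in (_ < X)%N]N0.
have J0 : (0 < J)%N by apply: leq_ltn_trans (ltn_ord i).
pose h m := \sum_(q < Q) theta q m * rayleigh A (v i) q 0.
have hE m : h m = sesqui (M m) (v i) (v i) / sqnorm (v i).
  exact: sum_rayleigh.
pose l := lambda_min (M (mu i)).
have [g g0 gap] := spectral_gap (hM (mu i)) mui_simple (v_neq0 i) (v_eigen i).
have [c [delta delta0 lower]] := sesqui_perturbation_ge A
  (hermsymmxP (hM (mu i))) (v_neq0 i) (v_eigen i) g0 gap.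
pose B m := \sum_(q < Q) c q * (theta q m - theta q (mu i)) ^+ 2.
have dB : is_diff (mu i) B 0 by apply: is_diff_sum_sqr0.
have B0 : B (mu i) = 0.
  by rewrite /B big1 // => q _; rewrite subrr expr0n mulr0.
have dh : differentiable h (mu i).
  have -> : h = \sum_(q < Q) (rayleigh A (v i) q 0 *: theta q).
    apply/funext => m; rewrite fct_sumE /h.
    by apply: eq_bigr => q _; rewrite mulrC.
  by apply: differentiable_sum => q; exact: differentiableZ.
have h_mui : h (mu i) = l.
  rewrite hE (sesqui_eigen (v_eigen i)) mulfK //.
  by rewrite lt0r_neq0 // sqnorm_gt0.
have min_UB m : lambda_min (M m) <= lambda_UB theta A v m.
  (* The minimum is attained at some [v j], where it is a Rayleigh quotient of [M m]. *)
  have [[y [j ->] ->] _] := lambda_UBP theta A v m J0.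
  rewrite sum_rayleigh ler_pdivlMr ?sqnorm_gt0 //.
  exact: lambda_min_sesqui_le.
have UB_h m : lambda_UB theta A v m <= h m.
  by have [_ ->] := lambda_UBP theta A v m J0; last by exists i.
have near_lower : \forall m \near mu i, h m - B m <= lambda_min (M m).
  (* By continuity, since [h (mu i) = l]; this and [near_theta] are the smallness conditions of
     [lower]. *)
  have near_h : \forall m \near mu i, h m <= l + g / 4.
    have hc : h @ mu i --> h (mu i) by exact: differentiable_continuous.
    by apply: (cvgr_le (h (mu i)) hc); rewrite h_mui ltrDl divr_gt0.
  have near_theta : \forall m \near mu i,
      forall q, `|theta q m - theta q (mu i)| <= delta.
    apply: (@filter_forall _ _
      (fun q m => `|theta q m - theta q (mu i)| <= delta) (nbhs (mu i))) => q.
    have tc : theta q @ mu i --> theta q (mu i).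
      exact: differentiable_continuous.
    exact: (cvgr_distC_le _ _ tc _ delta0).
  apply: filterS2 near_h near_theta => m hm tm.
  (* Evaluating the form at an eigenvector for [lambda_min (M m)] turns the lower bound on the form
     into one on the eigenvalue. *)
  have [u u0 Mu] := lambda_min_eigenvector N0 (hM m).
  rewrite -(ler_pM2r (sqnorm_gt0 u0)) -(sesqui_eigen Mu) hE.
  apply: (lower (fun q => theta q m - theta q (mu i))) => //.
  - exact: hermsymmxP.
  - rewrite /M /parametric_mx -big_split /=; apply: eq_bigr => q _.
    by rewrite -scalerDl -rmorphD addrC subrK.
  - by rewrite -hE.
have dhE : is_diff (mu i) h ('d h (mu i)) by exact/differentiableP.
have dmin : is_diff (mu i) (fun m => lambda_min (M m)) ('d h (mu i)).
  apply: is_diff_sandwich dB B0 dhE _; apply: filterS near_lower => m -> /=.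
  exact: le_trans (min_UB m) (UB_h m).
have dUB : is_diff (mu i) (lambda_UB theta A v) ('d h (mu i)).
  apply: is_diff_sandwich dB B0 dhE _; apply: filterS near_lower => m hB.
  by rewrite UB_h andbT (le_trans hB).
split; [exact: ex_diff | exact: ex_diff |].
by rewrite (gradient_is_diff dUB) (gradient_is_diff dmin).
Qed.
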